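(* The eight one-dimensional representations of $\mathfrak{G}$ are indexed by pairs $(a,b)$ with $a\in\{0,1,2,3\}$ and $b\in\{0,1\}$, where $\rho_{a,b}(T)=(-1)^b$ and $\rho_{a,b}(D)=i^a$, and the module $M(\rho_{a,b})$ is a free $\mathfrak{R}$-module of rank $1$ generated by $\Gamma^a\Delta^b$: $$M(\rho_{a,b})=\mathfrak{R}\,\Gamma^a\Delta^b .$$ In particular, for $\rho_1,\rho_2,\dots,\rho_8$ the generators are, respectively, $$1,\quad \Gamma^2,\quad \Gamma,\quad \Gamma^3,\quad \Delta,\quad \Gamma^2\Delta,\quad \Gamma\Delta,\quad \Gamma^3\Delta,$$ and the Hilbert series $\sum_{d\ge0}\dim_{\mathbb{C}}(M(\rho_j)_d)\,t^d$ is $$\frac{t^{k}}{(1-t^8)(1-t^{24})},$$ with $k=0,12,6,18,12,24,18,30$ for $j=1,\dots,8$ respectively.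
   Context: $\mathfrak{G}\subset\mathrm{GL}(2,\mathbb{C})$ is the finite group (of order $192$) generated by $T=\frac{1}{\sqrt2}\begin{pmatrix}1&1\\1&-1\end{pmatrix}$ and $D=\begin{pmatrix}1&0\\0&i\end{pmatrix}$. It acts on $\mathbb{C}[x,y]$ by $(g\cdot f)(\mathbf{x})=f(g\mathbf{x})$, $\mathbf{x}=(x,y)^{\mathsf T}$, and $\mathfrak{R}=\mathbb{C}[x,y]^{\mathfrak{G}}$ is the invariant ring; $\mathfrak{R}=\mathbb{C}[\theta,\varphi]$ with $\theta=x^8+14x^4y^4+y^8$ and $\varphi=x^{24}+759x^{16}y^8+2576x^{12}y^{12}+759x^8y^{16}+y^{24}$ algebraically independent. Further, $$\Gamma=-x^5y+xy^5,\qquad \Delta=x^{12}-33x^8y^4-33x^4y^8+y^{12}.$$ For a representation $\rho:\mathfrak{G}\to\mathrm{GL}(m,\mathbb{C})$, the module of vector-valued invariants is $$M(\rho)=\{F\in\mathbb{C}[x,y]^m : F(\sigma\mathbf{x})=\rho(\sigma)F(\mathbf{x})\ \text{for all }\sigma\in\mathfrak{G}\},$$ a graded $\mathfrak{R}$-module; $M(\rho)_d$ is the subspace of elements whose components are homogeneous of degree $d$. The one-dimensional representations $\rho_1,\dots,\rho_8$ are given by $(\rho_j(T),\rho_j(D))=(1,1),(1,-1),(1,i),(1,-i),(-1,1),(-1,-1),(-1,i),(-1,-i)$ for $j=1,\dots,8$ respectively. *)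

(* Defs.v *)
From HB Require Import structures.
From mathcomp Require Import all_boot all_order all_algebra.
From mathcomp Require Export complex.
From mathcomp Require Export reals.
From mathcomp Require Export mpoly.

Set Implicit Arguments.
Unset Strict Implicit.
Unset Printing Implicit Defensive.

Import GRing.Theory Num.Theory.

Local Open Scope ring_scope.

(* e is a basis of N over the subring S of A: N is exactly the set of
   S-linear combinations of e, and e is linearly independent over S.
   S is a parameter because two scalar rings inside A = C[x,y] occur:
   the invariant ring, and the constants C. *)
Definition is_basis (A : nzRingType) (S : A -> Prop) (V : lmodType A)
    (N : V -> Prop) (n : nat) (e : 'I_n -> V) : Prop :=
  (forall v, N v <-> exists c : 'I_n -> A,
      (forall i, S (c i)) /\ v = \sum_(i < n) c i *: e i) /\
  (forall c : 'I_n -> A, (forall i, S (c i)) ->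
      \sum_(i < n) c i *: e i = 0 -> forall i, c i = 0).

(* The formal power series h satisfies h = p / q in Z[[t]], i.e. q * h = p
   for the Cauchy product, q being invertible in Z[[t]]. *)
Definition fps_eq_frac (h : nat -> int) (p q : {poly int}) : Prop :=
  q`_0 \is a GRing.unit /\
  forall n : nat, \sum_(i < n.+1) q`_i * h (n - i)%N = p`_n.

Section VectorValuedInvariants.

Variable C : numClosedFieldType.

Definition mx2 (a b c d : C) : 'M[C]_2 :=
  \matrix_(i < 2, j < 2) (nth [::] [:: [:: a; b]; [:: c; d]] i)`_j.

Definition Tmx : 'M[C]_2 := (sqrtC 2)^-1 *: mx2 1 1 1 (- 1).
Definition Dmx : 'M[C]_2 := mx2 1 0 0 'i.

(* The subgroup of GL(2,C) generated by T and D. *)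
Inductive inG : 'M[C]_2 -> Prop :=
| inG_T : inG Tmx
| inG_D : inG Dmx
| inG_1 : inG 1%:M
| inG_M g h : inG g -> inG h -> inG (g *m h)
| inG_V g : inG g -> inG (invmx g).

Definition X : {mpoly C[2]} := 'X_ord0.
Definition Y : {mpoly C[2]} := 'X_ord_max.

(* (g . f)(x) = f(g x), where x is the column vector of the variables. *)
Definition mact (g : 'M[C]_2) (f : {mpoly C[2]}) : {mpoly C[2]} :=
  f \mPo [tuple \sum_(j < 2) g i j *: 'X_j | i < 2].

Definition invariant (f : {mpoly C[2]}) : Prop :=
  forall g, inG g -> mact g f = f.

(* As for mx_repr, a representation is a total function on matrices of which
   only the values on the group are relevant. *)
Definition is_rep (m : nat) (rho : 'M[C]_2 -> 'M[C]_m) : Prop :=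
  (forall g, inG g -> rho g \in unitmx) /\
  (forall g h, inG g -> inG h -> rho (g *m h) = rho g *m rho h).

Definition vinv (m : nat) (rho : 'M[C]_2 -> 'M[C]_m)
    (F : 'cV[{mpoly C[2]}]_m) : Prop :=
  forall g, inG g -> map_mx (mact g) F = map_mx (@mpolyC 2 C) (rho g) *m F.

Definition vinv_deg (m : nat) (rho : 'M[C]_2 -> 'M[C]_m) (d : nat)
    (F : 'cV[{mpoly C[2]}]_m) : Prop :=
  vinv rho F /\ forall i, F i 0 \is d.-homog.

Definition constant (r : {mpoly C[2]}) : Prop := exists c : C, r = c%:MP.

Definition has_dim (m : nat) (N : 'cV[{mpoly C[2]}]_m -> Prop) (n : nat) :
    Prop :=
  exists e : 'I_n -> 'cV[{mpoly C[2]}]_m, is_basis constant N e.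

Definition hilbert_series_eq (m : nat) (rho : 'M[C]_2 -> 'M[C]_m)
    (p q : {poly int}) : Prop :=
  exists h : nat -> nat,
    (forall d, has_dim (vinv_deg rho d) (h d)) /\
    fps_eq_frac (fun d => (h d)%:Z) p q.

(* M(rho) = R g, free of rank 1 with basis g, for rho of degree 1. *)
Definition free_gen (rho : 'M[C]_2 -> 'M[C]_1) (g : {mpoly C[2]}) : Prop :=
  (forall F, vinv rho F <->
     exists r, invariant r /\ F = r *: (const_mx g : 'cV_1)) /\
  is_basis invariant (vinv rho) (fun _ : 'I_1 => const_mx g : 'cV_1).

Definition Gamma : {mpoly C[2]} := - X ^+ 5 * Y + X * Y ^+ 5.
Definition Delta : {mpoly C[2]} :=
  X ^+ 12 - 33 *: (X ^+ 8 * Y ^+ 4) - 33 *: (X ^+ 4 * Y ^+ 8) + Y ^+ 12.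

(* The values at (T, D) determine a representation of degree 1 on the group. *)
Definition is_rep1 (t d : C) (rho : 'M[C]_2 -> 'M[C]_1) : Prop :=
  [/\ is_rep rho, rho Tmx = t%:M & rho Dmx = d%:M].

(* The data of rho_1, ..., rho_8, at positions 0, ..., 7. *)
Definition rho_values : seq (C * C) :=
  [:: (1, 1); (1, - 1); (1, 'i); (1, - 'i);
      (- 1, 1); (- 1, - 1); (- 1, 'i); (- 1, - 'i)].

Definition rho_generators : seq {mpoly C[2]} :=
  [:: 1; Gamma ^+ 2; Gamma; Gamma ^+ 3;
      Delta; Gamma ^+ 2 * Delta; Gamma * Delta; Gamma ^+ 3 * Delta].

Definition rho_degrees : seq nat := [:: 0; 12; 6; 18; 12; 24; 18; 30]%N.

End VectorValuedInvariants.

Arguments rho_values C : clear implicits.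
Arguments rho_generators C : clear implicits.
Arguments Gamma C : clear implicits.
Arguments Delta C : clear implicits.

(* Main.v *)
From HB Require Import structures.
Require Import Defs.
From mathcomp Require Import all_boot all_order all_algebra.
From mathcomp Require Import ring zify.

Import GRing.Theory Num.Theory.
Local Open Scope ring_scope.

(** The generators T and D determine a character of the group, and T^2 = D^4 = 1
    leaves only the eight values ((-1)^b, i^a). All of them occur: Gamma and
    Delta are relative invariants with values (1, i) and (-1, 1), and the
    character of a nonzero relative invariant f can be read off as the ratio of
    the values of f o g and f at a point where f does not vanish.

    Let f be a relative invariant of exponents (a, b), homogeneous of degree d.
    Everything rests on the value of f at the point (1, 0).

    - If f(1, 0) = 0, then f vanishes on the orbit of the line through (1, 0),
      which consists of the six lines through (1, 0), (0, 1), (1, 1), (1, i),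
      (1, -1), (1, -i). These are the zeros of Gamma, so Gamma divides f
      [Gamma_dvd], and the quotient has exponents (a - 1, b).
    - D fixes (1, 0), so f(1, 0) = 0 as soon as i^a <> 1. Hence Gamma^a divides
      f, and a = 0 may be assumed [Gamma_pow_dvd].
    - If a = 0 and f(1, 0) <> 0, then, with theta = x^8 + 14 x^4 y^4 + y^8, the
      form Delta^b theta^m has the degree of f for some m [relinv0_degree].
      Subtracting a multiple of it from f gives a form vanishing at (1, 0); as
      its exponent a is 0 = 4 modulo 4, this form is divisible by Gamma^4.

    Induction on d gives M(rho_{a,b}) = Gamma^a Delta^b C[theta, Gamma^4]
    [relinv_span]. As theta and Gamma^4 are invariants, Gamma^a Delta^b
    generates this module over the ring of invariants. The monomials in theta
    and Gamma^4 are independent [inv_basis_free], because at (1, 0) theta has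
    the value 1 and Gamma the value 0; as theta and Gamma^4 have degrees 8 and
    24, the Hilbert series follows. *)

Section RelativeInvariants.

Set Implicit Arguments.
Unset Strict Implicit.
Unset Printing Implicit Defensive.

Variable C : numClosedFieldType.
Implicit Types (f g : {mpoly C[2]}) (A B : 'M[C]_2) (q : {poly C}).

Local Notation X := (Defs.X C).
Local Notation Y := (Defs.Y C).
Local Notation Gamma := (Defs.Gamma C).
Local Notation Delta := (Defs.Delta C).
Local Notation s := ((sqrtC (2 : C))^-1).

(** * The action of the group on polynomials *)

HB.instance Definition _ A := GRing.LRMorphism.copy (@mact C A)
  (comp_mpoly [tuple \sum_(j < 2) A i j *: 'X_j | i < 2]).

Lemma mact_var A i : mact A 'X_i = \sum_(j < 2) A i j *: 'X_j.
Proof. by rewrite /mact comp_mpolyXU -tnth_nth tnth_mktuple. Qed.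

Lemma mact1 f : mact 1%:M f = f.
Proof.
rewrite -[RHS]comp_mpoly_id; congr (_ \mPo _).
apply: eq_from_tnth => i; rewrite !tnth_mktuple (bigD1 i) //= big1 => [|j nij].
  by rewrite mxE eqxx scale1r addr0.
by rewrite mxE eq_sym (negPf nij) scale0r.
Qed.

(* Unification must not unfold the substitution when it looks for a morphism. *)
#[local] Opaque mact.

Lemma lrmorph_mpoly_ext
    (F G : {lrmorphism {mpoly C[2]} -> {mpoly C[2]}}) :
  (forall i, F 'X_i = G 'X_i) -> F =1 G.
Proof.
move=> eqFG f; rewrite [f]mpolyE !raddf_sum; apply: eq_bigr => m _ /=.
rewrite !linearZ mpolyXE_id /= (rmorph_prod F) (rmorph_prod G).
by congr (_ *: _); apply: eq_bigr => i _; rewrite !rmorphXn /= eqFG.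
Qed.

(** Both sides are algebra morphisms, so it is enough to compare them at the
    variables, where this is the associativity of A B x. *)
Lemma mactM A B f : mact (A *m B) f = mact B (mact A f).
Proof.
apply: (lrmorph_mpoly_ext (F := mact (A *m B)) (G := mact B \o mact A)) => i.
rewrite /= !mact_var raddf_sum /=.
under [RHS]eq_bigr => j _.
  rewrite linearZ /= mact_var scaler_sumr.
  under eq_bigr => k _ do rewrite scalerA.
  over.
rewrite exchange_big /=; apply: eq_bigr => k _.
by rewrite mxE scaler_suml.
Qed.

Lemma sqr_s : s ^+ 2 * 2 = 1.
Proof. by rewrite exprVn sqrtCK mulVf // pnatr_eq0. Qed.

Lemma mact_T_X : mact (Tmx C) X = s%:MP * (X + Y).
Proof.
rewrite mact_var big_ord_recl big_ord1 !mxE /= !mulr1 -!mul_mpolyC mulrDr.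
by congr (_ + _ * 'X_ _); apply: val_inj.
Qed.

Lemma mact_T_Y : mact (Tmx C) Y = s%:MP * (X - Y).
Proof.
rewrite mact_var big_ord_recl big_ord1 !mxE /= !mulrN !mulr1 -!mul_mpolyC.
by rewrite mulrDr mpolyCN mulNr mulrN; congr (_ + - _).
Qed.

Lemma mact_D_X : mact (Dmx C) X = X.
Proof.
by rewrite mact_var big_ord_recl big_ord1 !mxE /= scale1r scale0r addr0.
Qed.

Lemma mact_D_Y : mact (Dmx C) Y = 'i%:MP * Y.
Proof.
rewrite mact_var big_ord_recl big_ord1 !mxE /= scale0r add0r -mul_mpolyC.
by congr (_ * 'X_ _); apply: val_inj.
Qed.

(** * Relative invariants *)

(** The exponents stand for the character with values (-1)^b at T and i^a at D;
    they matter modulo 2 and 4 only, but as natural numbers they add up when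
    relative invariants are multiplied. *)
Definition relinv (a b : nat) f : Prop :=
  mact (Tmx C) f = (-1) ^+ b *: f /\ mact (Dmx C) f = 'i ^+ a *: f.

Lemma relinvM a b a' b' f g :
  relinv a b f -> relinv a' b' g -> relinv (a + a') (b + b') (f * g).
Proof.
move=> [fT fD] [gT gD]; split.
  by rewrite rmorphM /= fT gT exprD -!mul_mpolyC mpolyCM; ring.
by rewrite rmorphM /= fD gD exprD -!mul_mpolyC mpolyCM; ring.
Qed.

Lemma relinv1 : relinv 0 0 1.
Proof. by split; rewrite rmorph1 scale1r. Qed.

Lemma relinvX a b f n : relinv a b f -> relinv (a * n) (b * n) (f ^+ n).
Proof.
move=> hf; elim: n => [|n IHn]; first by rewrite !muln0; exact: relinv1.
by rewrite !mulnS exprS; apply: relinvM.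
Qed.

Lemma relinvD a b f g : relinv a b f -> relinv a b g -> relinv a b (f + g).
Proof.
by move=> [fT fD] [gT gD]; split; rewrite raddfD /= ?(fT, gT, fD, gD) scalerDr.
Qed.

Lemma relinvZ a b c f : relinv a b f -> relinv a b (c *: f).
Proof.
by move=> [fT fD]; split; rewrite linearZ /= ?(fT, fD) !scalerA mulrC.
Qed.

Lemma relinv0 a b : relinv a b 0.
Proof. by split; rewrite raddf0 scaler0. Qed.

Lemma relinv_cancel a b a' b' f g : f != 0 ->
  relinv a b f -> relinv (a + a') (b + b') (f * g) -> relinv a' b' g.
Proof.
move=> f0 [fT fD] [hT hD]; split.
  have f1 : ((-1) ^+ b : C)%:MP * f != 0.
    by rewrite mulf_neq0 // mpolyC_eq0 expf_eq0 oppr_eq0 oner_eq0 andbF.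
  apply: (mulfI f1); move: hT; rewrite rmorphM /= fT exprD -!mul_mpolyC.
  by rewrite mpolyCM => ->; ring.
have f1 : ('i ^+ a : C)%:MP * f != 0.
  by rewrite mulf_neq0 // mpolyC_eq0 expf_eq0 (negPf (neq0Ci C)) andbF.
apply: (mulfI f1); move: hD; rewrite rmorphM /= fD exprD -!mul_mpolyC.
by rewrite mpolyCM => ->; ring.
Qed.

Lemma i4 : 'i ^+ 4 = 1 :> C.
Proof. by rewrite (exprM _ 2 2) sqrCi sqrrN expr1n. Qed.

Lemma relinv_add4 a b f : relinv (a + 4) b f <-> relinv a b f.
Proof. by rewrite /relinv exprD i4 mulr1. Qed.

Definition theta : {mpoly C[2]} := X ^+ 8 + 14 *: (X ^+ 4 * Y ^+ 4) + Y ^+ 8.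

Lemma mpolyC_s2 : s%:MP ^+ 2 * 2 = 1 :> {mpoly C[2]}.
Proof. by rewrite -rmorphXn -mpolyC_nat -mpolyCM sqr_s. Qed.

Lemma mpolyC_i2 : 'i%:MP ^+ 2 = -1 :> {mpoly C[2]}.
Proof. by rewrite -rmorphXn /= sqrCi mpolyCN mpolyC1. Qed.

Lemma natZ (n : nat) f : (n%:R : C) *: f = n%:R * f.
Proof. by rewrite scaler_nat mulr_natl. Qed.

Lemma rmorph_Gamma (S : comNzRingType) (F : {rmorphism {mpoly C[2]} -> S}) :
  F Gamma = - F X ^+ 5 * F Y + F X * F Y ^+ 5.
Proof. by rewrite rmorphD !rmorphM rmorphN !rmorphXn. Qed.

Lemma rmorph_Delta (S : comNzRingType) (F : {rmorphism {mpoly C[2]} -> S}) :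
  F Delta = F X ^+ 12 - 33 * (F X ^+ 8 * F Y ^+ 4)
            - 33 * (F X ^+ 4 * F Y ^+ 8) + F Y ^+ 12.
Proof.
(* With abstract exponents, matching cannot unfold the powers. *)
have expand n a b c d e h :
    F (X ^+ a - n%:R *: (X ^+ b * Y ^+ c) - n%:R *: (X ^+ d * Y ^+ e) + Y ^+ h)
    = F X ^+ a - n%:R * (F X ^+ b * F Y ^+ c) - n%:R * (F X ^+ d * F Y ^+ e)
      + F Y ^+ h.
  by rewrite !natZ !(rmorphD, rmorphN, rmorphM, rmorph_nat, rmorphXn).
exact: expand.
Qed.

Lemma rmorph_theta (S : comNzRingType) (F : {rmorphism {mpoly C[2]} -> S}) :
  F theta = F X ^+ 8 + 14 * (F X ^+ 4 * F Y ^+ 4) + F Y ^+ 8.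
Proof.
have expand n a b c d : F (X ^+ a + n%:R *: (X ^+ b * Y ^+ c) + Y ^+ d)
    = F X ^+ a + n%:R * (F X ^+ b * F Y ^+ c) + F Y ^+ d.
  by rewrite !natZ !(rmorphD, rmorphM, rmorph_nat, rmorphXn).
exact: expand.
Qed.

Lemma relinv_Gamma : relinv 1 0 Gamma.
Proof.
split; rewrite rmorph_Gamma /= /Defs.Gamma.
  rewrite mact_T_X mact_T_Y scale1r.
  move: (s%:MP) mpolyC_s2 => S S2.
  (* The forms agree up to a power of 2 s^2 = 1. *)
  transitivity ((S ^+ 2 * 2) ^+ 3 * (- X ^+ 5 * Y + X * Y ^+ 5)); first by ring.
  by rewrite S2; ring.
rewrite mact_D_X mact_D_Y -mul_mpolyC.
move: ('i%:MP) mpolyC_i2 => I I2.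
by ring: I2.
Qed.

Lemma relinv_Delta : relinv 0 1 Delta.
Proof.
split; rewrite rmorph_Delta /= /Defs.Delta !natZ.
  rewrite mact_T_X mact_T_Y scaleN1r.
  move: (s%:MP) mpolyC_s2 => S S2.
  transitivity (- (S ^+ 2 * 2) ^+ 6 *
      (X ^+ 12 - 33 * (X ^+ 8 * Y ^+ 4) - 33 * (X ^+ 4 * Y ^+ 8) + Y ^+ 12)).
    by ring.
  by rewrite S2; ring.
rewrite mact_D_X mact_D_Y -mul_mpolyC.
move: ('i%:MP) mpolyC_i2 => I I2.
by ring: I2.
Qed.

Lemma relinv_theta : relinv 0 0 theta.
Proof.
split; rewrite rmorph_theta /= /theta !natZ.
  rewrite mact_T_X mact_T_Y scale1r.
  move: (s%:MP) mpolyC_s2 => S S2.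
  transitivity ((S ^+ 2 * 2) ^+ 4 *
      (X ^+ 8 + 14 * (X ^+ 4 * Y ^+ 4) + Y ^+ 8)).
    by ring.
  by rewrite S2; ring.
rewrite mact_D_X mact_D_Y scale1r.
move: ('i%:MP) mpolyC_i2 => I I2.
by ring: I2.
Qed.

(** * Values at points *)

Definition ev f (a b : C) : C := f.@[fun i => if i == ord0 then a else b].

Lemma ev_mact A f a b :
  ev (mact A f) a b =
  ev f (A ord0 ord0 * a + A ord0 ord_max * b)
       (A ord_max ord0 * a + A ord_max ord_max * b).
Proof.
rewrite /ev comp_mpoly_meval; apply: meval_eq => i; rewrite tnth_mktuple.
rewrite big_ord_recl big_ord1 mevalD !mevalZ !mevalXU /=.
have -> : lift ord0 ord0 = ord_max :> 'I_2 by apply: val_inj.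
case: ifPn => [/eqP -> //|]; case: i => [[|[|]]] //= lt _.
by congr (A _ _ * _ + A _ _ * _); apply: val_inj.
Qed.

Lemma ev_mactT f a b :
  ev (mact (Tmx C) f) a b = ev f (s * (a + b)) (s * (a - b)).
Proof. by rewrite ev_mact !mxE /= !mulr1 mulrN1 mulNr mulrDr mulrBr. Qed.

Lemma ev_mactD f a b : ev (mact (Dmx C) f) a b = ev f a ('i * b).
Proof. by rewrite ev_mact !mxE /= !mul0r mul1r addr0 add0r. Qed.

Lemma ev0 a b : ev 0 a b = 0.
Proof. exact: meval0. Qed.

Lemma evM f g u v : ev (f * g) u v = ev f u v * ev g u v.
Proof. exact: mevalM. Qed.

Lemma evX f n u v : ev (f ^+ n) u v = ev f u v ^+ n.
Proof. exact: rmorphXn. Qed.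

Lemma evZ c f u v : ev (c *: f) u v = c * ev f u v.
Proof. exact: mevalZ. Qed.

Lemma evD f g u v : ev (f + g) u v = ev f u v + ev g u v.
Proof. exact: mevalD. Qed.

Lemma ev_Gamma a b : ev Gamma a b = - a ^+ 5 * b + a * b ^+ 5.
Proof. by rewrite /ev rmorph_Gamma /= !mevalXU. Qed.

Lemma ev_Delta a b :
  ev Delta a b =
  a ^+ 12 - 33 * (a ^+ 8 * b ^+ 4) - 33 * (a ^+ 4 * b ^+ 8) + b ^+ 12.
Proof. by rewrite /ev rmorph_Delta /= !mevalXU. Qed.

Lemma ev_theta a b : ev theta a b = a ^+ 8 + 14 * (a ^+ 4 * b ^+ 4) + b ^+ 8.
Proof. by rewrite /ev rmorph_theta /= !mevalXU. Qed.

(** * Binary forms and univariate polynomials *)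

(** The homogenization of q in degree d; it inverts f |-> f(1, t). *)
Definition form (d : nat) (q : {poly C}) : {mpoly C[2]} :=
  \sum_(k < d.+1) q`_k *: (X ^+ (d - k) * Y ^+ k).

Lemma form_is_linear d : linear (form d).
Proof.
move=> c p q; rewrite /form scaler_sumr -big_split; apply: eq_bigr => k _ /=.
by rewrite coefD coefZ scalerDl scalerA.
Qed.
HB.instance Definition _ d :=
  GRing.isLinear.Build C {poly C} {mpoly C[2]} _ (form d) (form_is_linear d).

Lemma form_mulX d q : form d.+1 ('X * q) = Y * form d q.
Proof.
rewrite /form big_ord_recl coefXM eqxx scale0r add0r mulr_sumr.
apply: eq_bigr => k _; rewrite lift0 coefXM /= subSS -scalerAr; congr (_ *: _).
by rewrite exprS mulrCA.
Qed.

Lemma form_mulXn d k q : form (k + d) ('X^k * q) = Y ^+ k * form d q.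
Proof.
elim: k => [|k IHk]; first by rewrite !mul1r.
by rewrite addSn !exprS -!mulrA form_mulX IHk.
Qed.

Lemma form_widen d k q : (size q <= d.+1)%N ->
  form (k + d) q = X ^+ k * form d q.
Proof.
move=> szq; elim: k => [|k IHk]; first by rewrite mul1r.
rewrite exprS -mulrA -IHk /form addSn big_ord_recr /=.
rewrite nth_default ?scale0r ?addr0; last first.
  by apply: leq_trans szq _; rewrite ltnS leq_addl.
rewrite mulr_sumr; apply: eq_bigr => j _; rewrite -scalerAr mulrA -exprS.
by rewrite -subSn // -ltnS.
Qed.

Lemma formXn d k : (k <= d)%N -> form d 'X^k = X ^+ (d - k) * Y ^+ k.
Proof.
move=> lekd; rewrite -{1}(subnKC lekd) -['X^k]mulr1 form_mulXn.
rewrite -[(d - k)%N]addn0 form_widen ?size_poly1 // /form big_ord1.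
by rewrite coef1 subnn !expr0 scale1r mulr1 [LHS]mulrC mulr1 addn0.
Qed.

Lemma dhomog_form d f : f \is d.-homog ->
  exists2 q : {poly C}, (size q <= d.+1)%N & f = form d q.
Proof.
move=> /dhomogP hf; rewrite [f]mpolyE big_seq.
apply: (big_ind (fun g =>
  exists2 q : {poly C}, (size q <= d.+1)%N & g = form d q)).
- by exists 0; rewrite ?size_poly0 ?raddf0.
- move=> _ _ [p hp ->] [q hq ->]; exists (p + q); last by rewrite raddfD.
  by apply: leq_trans (size_polyD _ _) _; rewrite geq_max hp.
move=> m /hf dm; have {}dm : (m ord0 + m ord_max = d)%N.
  rewrite -dm /= mdegE big_ord_recl big_ord1.
  by congr (_ + m _)%N; apply: val_inj.
exists (f@_m *: 'X^(m ord_max)).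
  apply: leq_trans (size_scale_leq _ _) _.
  by rewrite size_polyXn ltnS -dm leq_addl.
rewrite linearZ /= formXn -?dm ?leq_addl // addnK mpolyXE_id.
rewrite big_ord_recl big_ord1; congr (_ *: (_ * 'X__ ^+ m _)); exact: val_inj.
Qed.

Lemma X_dhomog : X \is 1.-homog.
Proof. by rewrite dhomogX /= mdeg1. Qed.

Lemma Y_dhomog : Y \is 1.-homog.
Proof. by rewrite dhomogX /= mdeg1. Qed.

Lemma monomial_dhomog d k l : (k + l = d)%N -> X ^+ k * Y ^+ l \is d.-homog.
Proof.
move=> <-; apply: dhomogM.
  by have := dhomogMn k X_dhomog; rewrite mul1n.
by have := dhomogMn l Y_dhomog; rewrite mul1n.
Qed.

Lemma form_dhomog d q : form d q \is d.-homog.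
Proof.
apply: rpred_sum => k _; apply: rpredZ; apply: monomial_dhomog.
by rewrite subnK // -ltnS.
Qed.

Lemma ev_form1 d q t : (size q <= d.+1)%N -> ev (form d q) 1 t = q.[t].
Proof.
move=> szq; rewrite (horner_coef_wide _ szq) /ev raddf_sum.
apply: eq_bigr => k _ /=.
by rewrite mevalZ mevalM !rmorphXn /= !mevalXU /= expr1n mul1r.
Qed.

Lemma ev_form01 d q : ev (form d q) 0 1 = q`_d.
Proof.
rewrite /ev raddf_sum (bigD1 ord_max) //= big1 => [|k nk].
  rewrite mevalZ mevalM !rmorphXn /= !mevalXU /=.
  by rewrite subnn expr0 expr1n !mulr1 addr0.
rewrite mevalZ mevalM !rmorphXn /= !mevalXU /= expr0n subn_eq0 leqNgt.
by rewrite ltn_neqAle nk -ltnS ltn_ord !mul0r mulr0.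
Qed.

Lemma ev_scale d f c a b : f \is d.-homog ->
  ev f (c * a) (c * b) = c ^+ d * ev f a b.
Proof.
move=> /dhomog_form [q _ ->]; rewrite /ev !raddf_sum mulr_sumr.
apply: eq_bigr => k _ /=; rewrite !mevalZ !mevalM !rmorphXn /= !mevalXU /=.
have -> : c ^+ d = c ^+ (d - k) * c ^+ k by rewrite -exprD subnK // -ltnS.
by rewrite !exprMn; ring.
Qed.

(** * Divisibility by Gamma *)

Lemma relinv_evT a b d f u v : relinv a b f -> f \is d.-homog ->
  s ^+ d * ev f (u + v) (u - v) = (-1) ^+ b * ev f u v.
Proof.
by move=> [fT _] fh; rewrite -(ev_scale _ _ _ fh) -ev_mactT fT /ev mevalZ.
Qed.

Lemma relinv_evD a b f u v : relinv a b f ->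
  ev f u ('i * v) = 'i ^+ a * ev f u v.
Proof. by move=> [_ fD]; rewrite -ev_mactD fD /ev mevalZ. Qed.

Lemma s_neq0 : s != 0.
Proof. by rewrite invr_eq0 sqrtC_eq0 pnatr_eq0. Qed.

(** Up to a factor, T sends (1, 0) to (1, 1) and (1, -1) to (0, 1), and D
    permutes the points (1, 1), (1, i), (1, -1), (1, -i) cyclically. *)
Lemma relinv_orbit a b d f : relinv a b f -> f \is d.-homog -> ev f 1 0 = 0 ->
  [/\ ev f 1 1 = 0, ev f 1 'i = 0, ev f 1 (-1) = 0, ev f 1 (- 'i) = 0
    & ev f 0 1 = 0].
Proof.
move=> hf fh f10.
have fT u v : ev f u v = 0 -> ev f (u + v) (u - v) = 0.
  move=> fuv; apply/eqP; have /eqP := relinv_evT u v hf fh.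
  by rewrite fuv mulr0 mulf_eq0 expf_eq0 (negPf s_neq0) andbF.
have fD u v : ev f u v = 0 -> ev f u ('i * v) = 0.
  by move=> fuv; rewrite (relinv_evD _ _ hf) fuv mulr0.
have f11 : ev f 1 1 = 0 by have := fT _ _ f10; rewrite addr0 subr0.
have f1i : ev f 1 'i = 0 by have := fD _ _ f11; rewrite mulr1.
have f1n : ev f 1 (-1) = 0 by have := fD _ _ f1i; rewrite -expr2 sqrCi.
have f1ni : ev f 1 (- 'i) = 0 by have := fD _ _ f1n; rewrite mulrN1.
split=> //; apply/eqP; have /eqP := fT _ _ f1n.
have -> : 1 + -1 = 2 * 0 :> C by rewrite subrr mulr0.
have -> : 1 - -1 = 2 * 1 :> C by ring.
by rewrite (ev_scale _ _ _ fh) mulf_eq0 expf_eq0 pnatr_eq0 andbF.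
Qed.

Lemma one_neqN1 : 1 != -1 :> C.
Proof. by rewrite -addr_eq0 -mulr2n pnatr_eq0. Qed.

Lemma i_neq1 : 'i != 1 :> C.
Proof.
by apply/eqP => i1; have := one_neqN1; rewrite -(sqrCi C) i1 expr1n eqxx.
Qed.

Lemma i_neqN1 : 'i != -1 :> C.
Proof.
by apply/eqP => i1; have := one_neqN1; rewrite -(sqrCi C) i1 sqrrN expr1n eqxx.
Qed.

Lemma expi_eq1 n : ('i ^+ n == 1 :> C) = (4 %| n)%N.
Proof.
rewrite [n in LHS](divn_eq n 4) exprD mulnC exprM i4 expr1n mul1r /dvdn.
have : (n %% 4 < 4)%N by rewrite ltn_mod.
case: (n %% 4)%N => [|[|[|[|]]]] // _; first by rewrite expr0 eqxx.
- exact/negbTE/i_neq1.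
- by rewrite sqrCi eq_sym; exact/negbTE/one_neqN1.
by rewrite exprS sqrCi mulrN1 eqr_oppLR; apply/negbTE/i_neqN1.
Qed.

Lemma Gamma_roots_dvd (q : {poly C}) :
  q.[0] = 0 -> q.[1] = 0 -> q.['i] = 0 -> q.[-1] = 0 -> q.[- 'i] = 0 ->
  ('X^5 - 'X %| q)%R.
Proof.
move=> q0 q1 qi qn1 qni.
have -> : 'X^5 - 'X
    = \prod_(z <- [:: 0; 1; 'i; -1; - 'i]) ('X - z%:P) :> {poly C}.
  rewrite !big_cons big_nil !polyCN.
  have I2 : 'i%:P ^+ 2 = -1 :> {poly C} by rewrite -rmorphXn /= sqrCi polyCN.
  rewrite polyC0 polyC1; move: ('i%:P) I2 => I I2; ring: I2.
apply: uniq_roots_dvdp; first by rewrite /= !rootE q0 q1 qi qn1 qni eqxx.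
have i_neq0 := neq0Ci C.
have n1i : 1 != - 'i :> C by rewrite eq_sym eqr_oppLR i_neqN1.
have nii : 'i != - 'i :> C by rewrite -addr_eq0 -mulr2n mulrn_eq0.
rewrite uniq_rootsE /= !inE !negb_or n1i nii i_neqN1 one_neqN1 eqr_opp.
by rewrite !(eq_sym 0) !oppr_eq0 !(eq_sym 1 'i) i_neq1 oner_eq0 i_neq0.
Qed.

(** Gamma is the homogenization of t^5 - t in degree 6 and not 5, which accounts
    for its zero at (0, 1). *)
Lemma Gamma_form d q : (size q <= d.+1)%N ->
  form (d + 6) (('X^5 - 'X) * q) = Gamma * form d q.
Proof.
move=> szq; rewrite mulrBl raddfB /=.
have -> : (d + 6 = 5 + (1 + d))%N by lia.
rewrite form_mulXn (form_widen 1) //.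
rewrite -['X]expr1 addnCA form_mulXn (form_widen 5) //.
by rewrite /Defs.Gamma; ring.
Qed.

(** The zeros at (1, 0), (1, i^k) make t^5 - t divide f(1, t), and the zero at
    (0, 1) lowers the degree of f(1, t) below d, which is what the quotient
    needs to be homogenized in degree d - 6. *)
Lemma Gamma_dvd a b d f : relinv a b f -> f \is d.-homog -> ev f 1 0 = 0 ->
  f = 0 \/ exists g, [/\ (6 <= d)%N, g \is (d - 6).-homog & f = Gamma * g].
Proof.
move=> hf fh f10; have [f11 f1i f1n f1ni f01] := relinv_orbit hf fh f10.
have [q szq fq] := dhomog_form fh; move: f10 f11 f1i f1n f1ni f01.
rewrite fq !(ev_form1 _ szq) ev_form01 => q0 q1 qi qn qni qd.
have /dvdpP [p qp] := Gamma_roots_dvd q0 q1 qi qn qni.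
have [p0|p0] := eqVneq p 0; first by left; rewrite qp p0 mul0r raddf0.
have szX : size ('X^5 - 'X : {poly C}) = 6%N.
  by rewrite size_polyDl size_polyXn // size_polyN size_polyX.
have X0 : 'X^5 - 'X != 0 :> {poly C} by rewrite -size_poly_eq0 szX.
have szq' : (size q <= d)%N.
  apply/leq_sizeP => j; rewrite leq_eqVlt => /predU1P[<- //|ltdj].
  by rewrite nth_default // (leq_trans szq).
have := szq'; rewrite qp size_mul // szX addnS /= => szp.
have p1 : (0 < size p)%N by rewrite size_poly_gt0.
have [le6d {}szp] : (6 <= d)%N /\ (size p <= (d - 6).+1)%N.
  by move: (size p) szp p1 => n; lia.
right; exists (form (d - 6) p); split=> //; first exact: form_dhomog.
by rewrite -Gamma_form // mulrC subnK.
Qed.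

Lemma Gamma_neq0 : Gamma != 0.
Proof.
apply/eqP => /(congr1 (fun f => ev f 1 2)) /eqP; rewrite ev_Gamma ev0.
have -> : - 1 ^+ 5 * 2 + 1 * 2 ^+ 5 = 30%:R :> C by ring.
by rewrite pnatr_eq0.
Qed.

Lemma ev_Delta10 : ev Delta 1 0 = 1.
Proof. by rewrite ev_Delta; ring. Qed.

Lemma ev_theta10 : ev theta 1 0 = 1.
Proof. by rewrite ev_theta; ring. Qed.

Lemma Delta_neq0 : Delta != 0.
Proof.
by apply/eqP => D0; have /eqP := ev_Delta10; rewrite D0 ev0 eq_sym oner_eq0.
Qed.

(** D fixes (1, 0), so that f(1, 0) = i^a f(1, 0). *)
Lemma relinv_vanish a b f : (0 < a < 4)%N -> relinv a b f -> ev f 1 0 = 0.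
Proof.
move=> a4 hf; have /eqP := relinv_evD 1 0 hf; rewrite mulr0 -subr_eq0.
rewrite -{1}[ev _ _ _]mul1r -mulrBl mulf_eq0 subr_eq0 eq_sym expi_eq1.
by case/orP=> [|/eqP //]; lia.
Qed.

(** The vanishing at (1, 0) is automatic for the exponents 1, 2, 3; it is only
    for the exponent 4, that of the trivial character on D, that it is an
    assumption. *)
Lemma Gamma_pow_dvd a b d f : (a <= 4)%N ->
  relinv a b f -> f \is d.-homog -> (a = 4 -> ev f 1 0 = 0) ->
  f = 0 \/ exists g, [/\ (6 * a <= d)%N, g \is (d - 6 * a).-homog, relinv 0 b g
                       & f = Gamma ^+ a * g].
Proof.
elim: a d f => [|a IHa] d f a4 hf fh f10.
  by right; exists f; rewrite muln0 subn0 mul1r.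
have {}f10 : ev f 1 0 = 0.
  move: a4; rewrite leq_eqVlt => /predU1P[/f10 //|a3].
  exact: relinv_vanish hf.
have [->|[g [le6d gh fg]]] := Gamma_dvd hf fh f10; first by left.
have hg : relinv a b g.
  by apply: relinv_cancel Gamma_neq0 relinv_Gamma _; rewrite -fg.
have [a_le4 a_neq4] : (a <= 4)%N /\ a <> 4 by lia.
have [//|g0|[g' [le6 gh' hg' gg']]] := IHa _ _ a_le4 hg gh.
  by left; rewrite fg g0 mulr0.
right; exists g'; split=> //; first by lia.
  by have -> : (d - 6 * a.+1 = d - 6 - 6 * a)%N by lia.
by rewrite fg gg' exprS mulrA.
Qed.

(** * Degrees and leading forms *)

(** Delta has degree 12, but degree 4 satisfies the same congruence modulo 8;
    this excludes it. Put z = f(1, 0). Applying T at (1, 0) gives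
    f(1, 1) = - 4 z, hence f(1, i^k) = - 4 z for all k; applying T at (1, -1)
    gives f(0, 1) = z. But the sum of the f(1, i^k) is four times the sum of the
    coefficients of x^4 and y^4, so that - 16 z = 8 z. *)
Lemma relinv_deg4 b f : odd b -> relinv 0 b f -> f \is 4.-homog -> ev f 1 0 = 0.
Proof.
move=> b_odd hf fh; have [q szq fq] := dhomog_form fh.
have fT u v : 4 * ev f u v = - ev f (u + v) (u - v).
  transitivity (- (2 ^+ 2 * (s ^+ 4 * ev f (u + v) (u - v)))).
    by rewrite (relinv_evT u v hf fh) -signr_odd b_odd; ring.
  transitivity (- ((s ^+ 2 * 2) ^+ 2 * ev f (u + v) (u - v))); first by ring.
  by rewrite sqr_s; ring.
have fD u v : ev f u ('i * v) = ev f u v by rewrite (relinv_evD _ _ hf) mul1r.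
have f11 : ev f 1 1 = - (4 * ev f 1 0) by rewrite fT addr0 subr0 opprK.
have f1i : ev f 1 'i = ev f 1 1 by rewrite -(fD 1 1) mulr1.
have f1n : ev f 1 (-1) = ev f 1 1 by rewrite -f1i -(fD 1 'i) -expr2 sqrCi.
have f1ni : ev f 1 (- 'i) = ev f 1 1 by rewrite -f1n -(fD 1 (-1)) mulrN1.
have four0 : 4 != 0 :> C by rewrite pnatr_eq0.
have f01 : ev f 0 1 = ev f 1 0.
  have := fT 1 (-1); rewrite addrN opprK.
  have -> : ev f 0 (1 + 1) = 2 ^+ 4 * ev f 0 1.
    by rewrite -(ev_scale _ _ _ fh) mulr0 mulr1.
  rewrite f1n f11 => h; apply: (mulfI four0); apply: (mulfI four0).
  apply: oppr_inj; transitivity (4 * - (4 * ev f 1 0)); last by ring.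
  by rewrite h; ring.
have : ev f 1 1 + ev f 1 'i + ev f 1 (-1) + ev f 1 (- 'i)
       = 4 * (ev f 1 0 + ev f 0 1).
  rewrite fq !(ev_form1 _ szq) ev_form01 !(horner_coef_wide _ szq).
  rewrite !big_ord_recr !big_ord0 /=.
  by have := sqrCi C; move: 'i => I I2; ring: I2.
rewrite f1i f1n f1ni f11 f01 => /eqP; rewrite -subr_eq0.
have -> : forall z : C,
    - (4 * z) + - (4 * z) + - (4 * z) + - (4 * z) - 4 * (z + z) = - (24%:R * z).
  by move=> z; ring.
by rewrite oppr_eq0 mulf_eq0 pnatr_eq0 => /eqP.
Qed.

(** The group contains the scalar (1 + i) / sqrt 2, a primitive eighth root of
    unity whose character value is (-1)^b. Instead of producing it as a word in
    T and D, the proof uses that T maps (1, i) to that multiple of (1, -i). *)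
Lemma relinv0_degree b d f : (b <= 1)%N -> relinv 0 b f -> f \is d.-homog ->
  ev f 1 0 != 0 -> (12 * b <= d)%N && (8 %| d - 12 * b)%N.
Proof.
move=> b_le1 hf fh f10.
have fD u v : ev f u ('i * v) = ev f u v by rewrite (relinv_evD _ _ hf) mul1r.
have f1i : ev f 1 'i = ev f 1 1 by rewrite -(fD 1 1) mulr1.
have f1n : ev f 1 (-1) = ev f 1 1.
  by rewrite -f1i -(fD 1 'i) -expr2 sqrCi.
have f1ni : ev f 1 (- 'i) = ev f 1 1 by rewrite -f1n -(fD 1 (-1)) mulrN1.
have f11 : ev f 1 1 != 0.
  apply: contraNneq f10 => f11; have /eqP := relinv_evT 1 0 hf fh.
  by rewrite addr0 subr0 f11 mulr0 eq_sym mulf_eq0 signr_eq0.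
have zeta_d : (s * (1 + 'i)) ^+ d = (-1) ^+ b.
  apply: (mulIf f11); rewrite -{2}f1i -(relinv_evT 1 'i hf fh) exprMn -mulrA.
  rewrite -f1ni -(ev_scale _ _ _ fh) mulr1 mulrN mulrDl mul1r -expr2 sqrCi.
  by congr (_ * ev f _ _); ring.
have zeta2 : (s * (1 + 'i)) ^+ 2 = 'i.
  transitivity (s ^+ 2 * (1 + 'i ^+ 2 + 2 * 'i)); first by ring.
  by rewrite sqrCi addrN add0r mulrA sqr_s mul1r.
have d4 : (4 %| d)%N.
  rewrite -expi_eq1 -zeta2 exprAC zeta_d -exprM mulnC exprM.
  by rewrite sqrrN !expr1n.
have e2 : odd (d %/ 4) = odd b.
  apply: (@signr_inj C); rewrite /= !signr_odd -zeta_d.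
  rewrite -[in RHS](divnK d4) mulnC.
  by rewrite -{2}[4%N]/(2 * 2)%N -mulnA exprM zeta2 exprM sqrCi.
case: b b_le1 hf e2 {zeta_d} => [|[|//]] _ hf /= e2; first by lia.
case: (ltnP d 12) => [d_lt12|]; last by lia.
have d_eq4 : d = 4 by lia.
by move: fh f10; rewrite d_eq4 => fh; rewrite (relinv_deg4 _ hf fh) ?eqxx.
Qed.

(** * The invariants of the group *)

(** The exponent of theta is the one that gives degree e, provided that 8
    divides e and 24 n <= e. *)
Definition inv_basis (e n : nat) : {mpoly C[2]} :=
  Gamma ^+ (4 * n) * theta ^+ ((e - 24 * n) %/ 8).

(** The coefficient of t^d in t^k / ((1 - t^8) (1 - t^24)): the number of
    monomials in theta and Gamma^4 of degree d - k. *)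
Definition hdim (k d : nat) : nat :=
  if (k <= d)%N && (8 %| d - k)%N then ((d - k) %/ 24).+1 else 0%N.

Lemma inv_basisS e n : inv_basis e n.+1 = Gamma ^+ 4 * inv_basis (e - 24) n.
Proof. by rewrite /inv_basis mulnS exprD -mulrA mulnS subnDA. Qed.

Lemma inv_basis0 e : inv_basis e 0 = theta ^+ (e %/ 8).
Proof. by rewrite /inv_basis muln0 mul1r subn0. Qed.

Lemma relinv_inv_basis e n : relinv 0 0 (inv_basis e n).
Proof.
have := relinvM (relinvX (4 * n) relinv_Gamma)
  (relinvX ((e - 24 * n) %/ 8) relinv_theta).
rewrite !mul0n mul1n addn0 -/(inv_basis e n) => -[hT hD]; split; first by [].
by rewrite hD exprM i4 expr1n.
Qed.

Lemma Gamma_dhomog : Gamma \is 6.-homog.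
Proof.
apply: rpredD; first by rewrite mulNr rpredN; apply: (@monomial_dhomog 6 5 1).
exact: (@monomial_dhomog 6 1 5).
Qed.

Lemma theta_dhomog : theta \is 8.-homog.
Proof.
apply: rpredD; last by have := @monomial_dhomog 8 0 8 erefl; rewrite mul1r.
apply: rpredD; first by have := @monomial_dhomog 8 8 0 erefl; rewrite mulr1.
by apply: rpredZ; apply: monomial_dhomog.
Qed.

Lemma Delta_dhomog : Delta \is 12.-homog.
Proof.
apply: rpredD; last by have := @monomial_dhomog 12 0 12 erefl; rewrite mul1r.
apply: rpredB; last by apply: rpredZ; apply: monomial_dhomog.
apply: rpredB; last by apply: rpredZ; apply: monomial_dhomog.
by have := @monomial_dhomog 12 12 0 erefl; rewrite mulr1.
Qed.

Lemma inv_basis_dhomog k d n : (n < hdim k d)%N ->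
  inv_basis (d - k) n \is (d - k).-homog.
Proof.
rewrite /hdim; case: ifP => // /andP[lekd dvd8] lt_n.
have := dhomogM (dhomogMn (4 * n) Gamma_dhomog)
  (dhomogMn ((d - k - 24 * n) %/ 8) theta_dhomog).
by have -> : (6 * (4 * n) + 8 * ((d - k - 24 * n) %/ 8) = d - k)%N by lia.
Qed.

(** Evaluation at (1, 0) isolates the term of index 0. *)
Lemma inv_basis_free N e (c : nat -> C) :
    \sum_(n < N) c n *: inv_basis e n = 0 ->
  forall n, (n < N)%N -> c n = 0.
Proof.
elim: N e c => [|N IHN] e c; first by [].
rewrite big_ord_recl inv_basis0.
under eq_bigr => n _ do rewrite lift0 inv_basisS scalerAr.
rewrite -mulr_sumr => sum0.
have c0 : c 0%N = 0.
  have := congr1 (fun f => ev f 1 0) sum0.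
  rewrite evD evZ evM !evX ev_theta10 ev_Gamma ev0 expr1n mulr1.
  by rewrite mulr0 expr0n /= mulr0 addr0 expr0n mul0r addr0.
move: sum0; rewrite c0 scale0r add0r => /eqP.
rewrite mulf_eq0 expf_eq0 (negPf Gamma_neq0) andbF => /eqP.
by move=> /(IHN _ (fun n => c n.+1)) cS [|n] //; exact: cS.
Qed.

Lemma hdim_sub24 k d : (24 <= d)%N -> hdim k (d - 24) = (hdim k d).-1.
Proof. by rewrite /hdim => le24; case: ifP; case: ifP => /=; lia. Qed.

(** Removing the multiple of Delta^b theta^m with the same value at (1, 0)
    leaves Gamma^4 times a relative invariant of degree d - 24. *)
Lemma relinv0_span b d f : (b <= 1)%N -> relinv 0 b f -> f \is d.-homog ->
  exists c : nat -> C,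
    f = Delta ^+ b * \sum_(n < hdim (12 * b) d) c n *: inv_basis (d - 12 * b) n.
Proof.
move=> b_le1; elim/ltn_ind: d f => d IHd f hf fh.
set k := (12 * b)%N; set h := Delta ^+ b * theta ^+ ((d - k) %/ 8).
have [g [hg gh g10 fg]] : exists g,
    [/\ relinv 0 b g, g \is d.-homog, ev g 1 0 = 0 & f = ev f 1 0 *: h + g].
  have [f10|f10] := eqVneq (ev f 1 0) 0.
    by exists f; rewrite f10 scale0r add0r.
  have /andP[lekd dvd8] := relinv0_degree b_le1 hf fh f10.
  have hh : relinv 0 b h.
    have := relinvM (relinvX b relinv_Delta)
      (relinvX ((d - k) %/ 8) relinv_theta).
    by rewrite !mul0n mul1n !addn0.
  have h10 : ev h 1 0 = 1.
    rewrite /h evM (evX Delta b) ev_Delta10 expr1n mul1r (evX theta).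
    by rewrite ev_theta10 expr1n.
  exists (f - ev f 1 0 *: h); split; last by rewrite addrC subrK.
  - by rewrite -scaleNr; apply: relinvD => //; apply: relinvZ.
  - apply: rpredB => //; apply: rpredZ.
    have := dhomogM (dhomogMn b Delta_dhomog)
      (dhomogMn ((d - k) %/ 8) theta_dhomog).
    by have -> : (12 * b + 8 * ((d - k) %/ 8) = d)%N by rewrite /k; lia.
  - by rewrite -scaleNr evD evZ h10; ring.
have [c gE] : exists c : nat -> C, g = Gamma ^+ 4 *
    (Delta ^+ b * \sum_(n < (hdim k d).-1) c n *: inv_basis (d - k - 24) n).
  have hg4 : relinv 4 b g by apply/(relinv_add4 0).
  have [g0|[g' [le24 gh' hg' gE]]] :=
    Gamma_pow_dvd (leqnn 4) hg4 gh (fun _ => g10).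
    by exists (fun _ => 0); rewrite g0 big1 ?mulr0 // => n _; rewrite scale0r.
  have [|c g'E] := IHd _ _ g' hg' gh'; first by lia.
  by exists c; rewrite gE g'E -hdim_sub24 // [(d - k - 24)%N]subnAC.
exists (fun n => if n is n'.+1 then c n' else ev f 1 0); rewrite {1}fg gE.
case hd: (hdim k d) => [|m] /=.
  have -> : ev f 1 0 = 0.
    apply/eqP; apply: contraT => f10.
    by move: hd; rewrite /hdim (relinv0_degree b_le1 hf fh f10).
  by rewrite !big_ord0 !mulr0 scale0r addr0.
rewrite big_ord_recl inv_basis0 mulrDr -scalerAr; congr (_ + _).
rewrite mulrCA; congr (_ * _); rewrite mulr_sumr; apply: eq_bigr => n _.
by rewrite lift0 inv_basisS -scalerAr.
Qed.

(** * The modules of relative invariants *)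

Lemma mact_dhomog A d f : f \is d.-homog -> mact A f \is d.-homog.
Proof.
move=> fh; rewrite [f]mpolyE (raddf_sum (mact A)) big_seq.
apply: rpred_sum => m.
move=> /(dhomog_mf fh) /= dm.
rewrite linearZ; apply: rpredZ; rewrite mpolyXE_id (rmorph_prod (mact A)) /=.
have lin i : mact A 'X_i \is 1.-homog.
  rewrite mact_var; apply: rpred_sum => j _; apply: rpredZ.
  by rewrite dhomogX /= mdeg1.
rewrite -dm mdegE !big_ord_recl !big_ord0 mulr1 addn0 !(rmorphXn (mact A)) /=.
apply: dhomogM.
  by have := dhomogMn (m ord0) (lin ord0); rewrite mul1n.
by have := dhomogMn (m (lift ord0 ord0)) (lin (lift ord0 ord0)); rewrite mul1n.
Qed.

Lemma pihomog_mact A d f :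
  mact A (pihomog mdeg d f) = pihomog mdeg d (mact A f).
Proof.
rewrite [f]mpolyE (raddf_sum (pihomog mdeg d)) !(raddf_sum (mact A)) raddf_sum.
apply: eq_bigr => m _ /=; rewrite !linearZ /=; congr (_ *: _).
have Xm : 'X_[C, m] \is (mdeg m).-homog by rewrite dhomogX.
have AXm := mact_dhomog A Xm.
have [dm|dm] := eqVneq (mdeg m) d; last first.
  by rewrite (pihomog_ne0 dm Xm) (pihomog_ne0 dm AXm) raddf0.
by rewrite -dm !pihomog_dE.
Qed.

Lemma relinv_pihomog a b d f : relinv a b f -> relinv a b (pihomog mdeg d f).
Proof. by move=> [fT fD]; split; rewrite pihomog_mact ?(fT, fD) linearZ. Qed.

Definition relgen a b : {mpoly C[2]} := Gamma ^+ a * Delta ^+ b.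

Lemma relgen_neq0 a b : relgen a b != 0.
Proof. by rewrite mulf_neq0 // expf_neq0 // (Gamma_neq0, Delta_neq0). Qed.

Lemma relinv_relgen a b : relinv a b (relgen a b).
Proof.
have := relinvM (relinvX a relinv_Gamma) (relinvX b relinv_Delta).
by rewrite !mul1n !mul0n addn0.
Qed.

Lemma relinv_span a b d f : (a < 4)%N -> (b <= 1)%N ->
    relinv a b f -> f \is d.-homog ->
  exists c : nat -> C, f = relgen a b *
    \sum_(n < hdim (6 * a + 12 * b) d)
      c n *: inv_basis (d - (6 * a + 12 * b)) n.
Proof.
move=> a_lt4 b_le1 hf fh.
have [|f0|[g [le_d gh hg fg]]] := Gamma_pow_dvd (ltnW a_lt4) hf fh.
- by lia.
- by exists (fun _ => 0); rewrite f0 big1 ?mulr0 // => n _; rewrite scale0r.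
have [c gE] := relinv0_span b_le1 hg gh; exists c; rewrite fg gE /relgen -mulrA.
by rewrite /hdim subnDA -leq_subRL.
Qed.

(** The group acts linearly, so the homogeneous components of a relative
    invariant are relative invariants of the same exponents. *)
Lemma relinv_factor a b f : (a < 4)%N -> (b <= 1)%N -> relinv a b f ->
  exists2 r, relinv 0 0 r & f = r * relgen a b.
Proof.
move=> a_lt4 b_le1 hf; rewrite (pihomog_partitionE (leqnn (mmeasure mdeg f))).
apply: (big_ind (fun g =>
  exists2 r, relinv 0 0 r & g = r * relgen a b)) => [||d _].
- by exists 0; rewrite ?mul0r //; apply: relinv0.
- move=> _ _ [p hp ->] [q hq ->]; exists (p + q); last by rewrite mulrDl.
  exact: relinvD.
have [c ->] :=
  relinv_span a_lt4 b_le1 (relinv_pihomog d hf) (pihomogP _ _ _).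
rewrite mulrC; eexists; last by [].
apply: (big_ind (relinv 0 0)) => [||n _]; [exact: relinv0 | exact: relinvD |].
by apply: relinvZ; apply: relinv_inv_basis.
Qed.

(** * Representations of degree one *)

Lemma mulmx_TT : Tmx C *m Tmx C = 1%:M.
Proof.
apply/matrixP => i j; rewrite !mxE big_ord_recl big_ord1 !mxE.
have s2 := sqr_s.
by case: i => [[|[|]]] // ?; case: j => [[|[|]]] // ?; rewrite /=;
  move: s s2 => s0 s2; rewrite ?mulr1n ?mulr0n; ring: s2.
Qed.

Lemma mulmx_DD : Dmx C *m Dmx C = mx2 1 0 0 (-1).
Proof.
apply/matrixP => i j; rewrite !mxE big_ord_recl big_ord1 !mxE.
have I2 := sqrCi C.
by case: i => [[|[|]]] // ?; case: j => [[|[|]]] // ?; rewrite /=;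
  move: 'i I2 => I I2; rewrite ?mulr1n ?mulr0n; ring: I2.
Qed.

Lemma mulmx_DDDD : (Dmx C *m Dmx C) *m (Dmx C *m Dmx C) = 1%:M.
Proof.
rewrite mulmx_DD; apply/matrixP => i j; rewrite !mxE big_ord_recl big_ord1 !mxE.
by case: i => [[|[|]]] // ?; case: j => [[|[|]]] // ?;
  rewrite /= ?mulr1n ?mulr0n; ring.
Qed.

Lemma Tmx_unit : Tmx C \in unitmx.
Proof. by have [] := mulmx1_unit mulmx_TT. Qed.

Lemma Dmx_unit : Dmx C \in unitmx.
Proof. by have := mulmx_DDDD; rewrite -mulmxA => /mulmx1_unit[]. Qed.

Lemma inG_unit A : inG A -> A \in unitmx.
Proof.
elim=> [|||g h _ ug _ uh|g _ ug]; rewrite ?Tmx_unit ?Dmx_unit ?unitmx1 //.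
  by rewrite unitmx_mul ug.
by rewrite unitmx_inv.
Qed.

Section Representation.

Variable rho : 'M[C]_2 -> 'M[C]_1.
Hypothesis rho_rep : is_rep rho.

Lemma rep_M A B : inG A -> inG B -> rho (A *m B) 0 0 = rho A 0 0 * rho B 0 0.
Proof. by move=> hA hB; rewrite rho_rep.2 // mxE big_ord1. Qed.

Lemma rep_1 : rho 1%:M 0 0 = 1.
Proof.
have u1 := rho_rep.1 _ (inG_1 C).
have u1' : rho 1%:M 0 0 != 0 by move: u1; rewrite unitmxE det_mx11 unitfE.
by apply: (mulfI u1'); rewrite -rep_M ?mul1mx ?mulr1 //; apply: inG_1.
Qed.

Lemma rep_V A : inG A -> rho A 0 0 * rho (invmx A) 0 0 = 1.
Proof.
by move=> hA; rewrite -rep_M ?mulmxV ?rep_1 ?inG_unit //; apply: inG_V.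
Qed.

Lemma mact_rep f :
    mact (Tmx C) f = rho (Tmx C) 0 0 *: f ->
    mact (Dmx C) f = rho (Dmx C) 0 0 *: f ->
  forall A, inG A -> mact A f = rho A 0 0 *: f.
Proof.
move=> fT fD A; elim=> [|||g h hg fg hh fh|g hg fg] //.
- by rewrite mact1 rep_1 scale1r.
- by rewrite mactM fg linearZ /= fh scalerA rep_M.
have fV : rho g 0 0 *: mact (invmx g) f = f.
  by rewrite -linearZ /= -fg -mactM mulmxV ?mact1 ?inG_unit.
by rewrite -{2}fV scalerA mulrC rep_V // scale1r.
Qed.

Lemma vinv_rep1 a b F :
    rho (Tmx C) 0 0 = (-1) ^+ b -> rho (Dmx C) 0 0 = 'i ^+ a ->
  vinv rho F <-> relinv a b (F 0 0).
Proof.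
move=> rT rD; split=> [hF|[fT fD] A hA].
  have comp A : inG A -> mact A (F 0 0) = rho A 0 0 *: F 0 0.
    move=> /hF /matrixP /(_ 0 0); rewrite !mxE big_ord1 mxE => ->.
    by rewrite mul_mpolyC.
  by split; rewrite comp ?(rT, rD) //; [exact: inG_T | exact: inG_D].
apply/matrixP => i j; rewrite !ord1 !mxE big_ord1 mxE mul_mpolyC.
by apply: mact_rep => //; rewrite (rT, rD).
Qed.

End Representation.

Lemma rep_ext (rho rho' : 'M[C]_2 -> 'M[C]_1) : is_rep rho -> is_rep rho' ->
    rho (Tmx C) = rho' (Tmx C) -> rho (Dmx C) = rho' (Dmx C) ->
  forall A, inG A -> rho A = rho' A.
Proof.
move=> hr hr' rT rD A; elim=> [|||g h hg rg hh rh|g hg rg] //.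
- by rewrite [LHS]mx11_scalar [RHS]mx11_scalar !rep_1.
- by rewrite hr.2 // hr'.2 // rg rh.
rewrite [LHS]mx11_scalar [RHS]mx11_scalar; congr (_%:M).
have rg0 : rho' g 0 0 != 0.
  apply/eqP => r0; have /eqP := rep_V hr' hg.
  by rewrite r0 mul0r eq_sym oner_eq0.
by apply: (mulfI rg0); rewrite rep_V // -rg rep_V.
Qed.

(** The factor by which a group element multiplies f is a character, and it is
    visible in the value at any point outside the zeros of f. The point (1, 2)
    is such a point for both Gamma and Delta. *)
Lemma semi_invariant_rep (t d : C) f : t != 0 -> d != 0 -> ev f 1 2 != 0 ->
    mact (Tmx C) f = t *: f -> mact (Dmx C) f = d *: f ->
  is_rep1 t d (fun A => (ev (mact A f) 1 2 / ev f 1 2)%:M).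
Proof.
move=> t0 d0 f12 fT fD.
set rho : 'M[C]_2 -> 'M[C]_1 := fun A => _.
have rhoE A c : mact A f = c *: f -> rho A = c%:M.
  by move=> fA; rewrite /rho fA evZ mulfK.
have char A : inG A -> exists2 c, c != 0 & mact A f = c *: f.
  elim=> [|||g h _ [c c0 fg] _ [c' c0' fh]|g hg [c c0 fg]].
  - by exists t.
  - by exists d.
  - by exists 1; rewrite ?oner_eq0 // mact1 scale1r.
  - exists (c * c'); first by rewrite mulf_neq0.
    by rewrite mactM fg linearZ /= fh scalerA.
  exists c^-1; first by rewrite invr_eq0.
  have {2}-> : f = c *: mact (invmx g) f.
    by rewrite -linearZ /= -fg -mactM mulmxV ?mact1 ?inG_unit.
  by rewrite scalerA mulVf // scale1r.
split; [split=> [A /char[c c0 /rhoE ->]|A B /char[c _ fA] /char[c' _ fB]] | |].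
- by rewrite unitmxE det_mx11 mxE mulr1n unitfE.
- rewrite (rhoE (A *m B) (c * c')).
    by rewrite (rhoE _ _ fA) (rhoE _ _ fB) scalar_mxM.
  by rewrite mactM fA linearZ /= fB scalerA.
- exact: rhoE.
exact: rhoE.
Qed.

Lemma rep_exists a b : exists rho : 'M[C]_2 -> 'M[C]_1,
  is_rep1 ((-1) ^+ b) ('i ^+ a) rho.
Proof.
have [gT gD] := relinv_relgen a b.
eexists; apply: (semi_invariant_rep _ _ _ gT gD).
- by rewrite signr_eq0.
- by rewrite expf_neq0 // neq0Ci.
rewrite evM (evX Gamma) (evX Delta) ev_Gamma ev_Delta.
have -> : - 1 ^+ 5 * 2 + 1 * 2 ^+ 5 = 30%:R :> C by ring.
have -> : 1 ^+ 12 - 33 * (1 ^+ 8 * 2 ^+ 4) - 33 * (1 ^+ 4 * 2 ^+ 8) + 2 ^+ 12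
  = - (4879%:R) :> C by ring.
by rewrite mulf_neq0 // expf_neq0 // ?oppr_eq0 pnatr_eq0.
Qed.

Lemma expi_inj a a' : (a < 4)%N -> (a' < 4)%N ->
  'i ^+ a = 'i ^+ a' :> C -> a = a'.
Proof.
wlog le_aa' : a a' / (a <= a')%N => [hw|] a4 a4' /eqP.
  by case: (leqP a a') => [|/ltnW] le /eqP ia; [|symmetry]; apply: hw.
rewrite -{1}(subnK le_aa') exprD -{1}[_ ^+ a]mul1r.
have ia0 : 'i ^+ a != 0 :> C by rewrite expf_neq0 // neq0Ci.
by rewrite (inj_eq (mulIf ia0)) eq_sym expi_eq1; lia.
Qed.

Lemma rep_exponents (rho : 'M[C]_2 -> 'M[C]_1) : is_rep rho ->
  exists! ab : 'I_4 * 'I_2, is_rep1 ((-1) ^+ ab.2) ('i ^+ ab.1) rho.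
Proof.
move=> hr; have hT := inG_T C; have hD := inG_D C.
have [b rT] : exists b : 'I_2, rho (Tmx C) 0 0 = (-1) ^+ b.
  have : rho (Tmx C) 0 0 ^+ 2 == 1.
    by rewrite expr2 -rep_M // mulmx_TT rep_1.
  by rewrite sqrf_eq1 => /orP[]/eqP ->; [exists 0|exists 1].
have [a rD] : exists a : 'I_4, rho (Dmx C) 0 0 = 'i ^+ a.
  have : (rho (Dmx C) 0 0 ^+ 2) ^+ 2 == 1.
    have hDD := inG_M hD hD.
    by rewrite !expr2 -!rep_M // mulmx_DDDD rep_1.
  rewrite sqrf_eq1 -{1}(expr1n _ 2) -sqrCi !eqf_sqr => /orP[]/orP[]/eqP ->.
  - by exists 0.
  - by exists (inord 2); rewrite inordK // sqrCi.
  - by exists 1.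
  by exists (inord 3); rewrite inordK // exprS sqrCi mulrN1.
exists (a, b); split=> [|[a' b'] [_ rT' rD']] /=.
  by split=> //; rewrite [LHS]mx11_scalar ?(rT, rD).
congr (_, _); apply: val_inj.
  have ia : 'i ^+ a = 'i ^+ a' :> C by rewrite -rD rD' mxE mulr1n.
  exact: expi_inj ia.
have : (-1) ^+ b = (-1) ^+ b' :> C by rewrite -rT rT' mxE mulr1n.
have odd_id (c : 'I_2) : val c = odd c by case: c => [[|[|]]].
rewrite -signr_odd -[RHS]signr_odd => /signr_inj eqb.
by rewrite odd_id [RHS]odd_id eqb.
Qed.

Lemma invariant_relinv f : Defs.invariant f <-> relinv 0 0 f.
Proof.
split=> [hf|[fT fD] A]; first by split; rewrite scale1r hf //; constructor.
have one_rep : is_rep (fun _ : 'M[C]_2 => 1%:M : 'M_1).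
  by split=> *; rewrite ?unitmx1 ?mulmx1.
have one00 : (1%:M : 'M[C]_1) 0 0 = 1 by rewrite mxE.
move=> hA; rewrite [RHS](_ : f = (1%:M : 'M[C]_1) 0 0 *: f); last first.
  by rewrite one00 scale1r.
by apply: (mact_rep one_rep) hA; rewrite one00 ?(fT, fD).
Qed.

(** * Free generators and Hilbert series *)

Lemma coef_Xn_conv (S : nzRingType) (h : nat -> S) m n :
  \sum_(i < n.+1) ('X^m : {poly S})`_i * h (n - i)%N
  = if (m <= n)%N then h (n - m)%N else 0.
Proof.
case: leqP => [le_mn|lt_nm].
  rewrite (bigD1 (Ordinal (le_mn : (m < n.+1)%N))) //= big1 ?addr0.
    by rewrite coefXn eqxx mul1r.
  move=> i ne_i; rewrite coefXn (_ : (nat_of_ord i == m) = false) ?mul0r //.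
  exact: negbTE ne_i.
rewrite big1 // => i _; rewrite coefXn ltn_eqF ?mul0r //.
by apply: leq_trans lt_nm; rewrite ltnS -ltnS.
Qed.

(** This is the recurrence for the coefficients of t^l / ((1 - t^8) (1 - t^24)),
    where (1 - t^8) (1 - t^24) = 1 - t^8 - t^24 + t^32; the negative terms are
    moved to the right-hand side, where natural numbers suffice. *)
Lemma hdim_rec l n :
  (hdim l n + (if 32 <= n then hdim l (n - 32) else 0)
   = (if 8 <= n then hdim l (n - 8) else 0)
     + (if 24 <= n then hdim l (n - 24) else 0) + (n == l))%N.
Proof.
rewrite /hdim; case: (leqP l n) => lt_l /=; last first.
  by do !(case: ifP => ?; try lia).
by do !(case: ifP => ?; try lia).
Qed.

Section Generator.

Variables (a b : nat) (rho : 'M[C]_2 -> 'M[C]_1).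
Hypotheses (a_lt4 : (a < 4)%N) (b_le1 : (b <= 1)%N).
Hypothesis rhoP : is_rep1 ((-1) ^+ b) ('i ^+ a) rho.

Let vinvE F : vinv rho F <-> relinv a b (F 0 0).
Proof.
have [hr rT rD] := rhoP.
by apply: vinv_rep1; rewrite ?rT ?rD ?mxE ?mulr1n.
Qed.

Lemma vinv_free_gen : free_gen rho (relgen a b).
Proof.
have mulgen (F : 'cV_1) r : F = r *: (const_mx (relgen a b) : 'cV_1) <->
    F 0 0 = r * relgen a b.
  split=> [->|F0]; first by rewrite !mxE.
  by apply/matrixP => i j; rewrite !ord1 F0 !mxE.
have vinvP F : vinv rho F <->
    exists r, Defs.invariant r /\ F = r *: (const_mx (relgen a b) : 'cV_1).
  rewrite vinvE; split=> [/(relinv_factor a_lt4 b_le1)[r hr F0]|[r [hr]]].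
    by exists r; split; [apply/invariant_relinv | apply/mulgen].
  move: hr => /invariant_relinv hr /mulgen ->.
  have := relinvM hr (relinv_relgen a b).
  by rewrite !add0n.
split=> //; split=> [F|c _].
  rewrite vinvP; split=> [[r [hr ->]]|[c [hc ->]]].
    by exists (fun _ => r); rewrite big_ord1.
  by exists (c 0); rewrite big_ord1.
rewrite big_ord1 => c0 i; rewrite ord1.
have /mulgen : 0 = c 0 *: (const_mx (relgen a b) : 'cV_1) by [].
rewrite mxE => /esym/eqP.
by rewrite mulf_eq0 (negPf (relgen_neq0 a b)) orbF => /eqP.
Qed.

Local Notation k := (6 * a + 12 * b)%N.

Lemma relgen_dhomog : relgen a b \is k.-homog.
Proof.
by apply: dhomogM; apply: dhomogMn; [exact: Gamma_dhomog | exact: Delta_dhomog].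
Qed.

Lemma vinv_has_dim d : has_dim (vinv_deg rho d) (hdim k d).
Proof.
pose p n := relgen a b * inv_basis (d - k) n.
have p_hom n : (n < hdim k d)%N -> p n \is d.-homog.
  move=> ltn; have := dhomogM relgen_dhomog (inv_basis_dhomog ltn).
  by move: ltn; rewrite /hdim; case: ifP => // /andP[lekd _] _; rewrite subnKC.
have p_rel n : relinv a b (p n).
  have := relinvM (relinv_relgen a b) (relinv_inv_basis (d - k) n).
  by rewrite !addn0.
have sumE (c : 'I_(hdim k d) -> {mpoly C[2]}) :
    (\sum_n c n *: (const_mx (p n) : 'cV_1)) 0 0 = \sum_n c n * p n.
  by rewrite summxE; apply: eq_bigr => n _; rewrite !mxE.
exists (fun n => const_mx (p n)); split=> [F|c c_const].
  split=> [[/vinvE hF /(_ 0) F_hom]|[c [c_const ->]]].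
    have [c F0] := relinv_span a_lt4 b_le1 hF F_hom.
    exists (fun n => (c n)%:MP); split=> [n|]; first by exists (c n).
    apply/matrixP => i j; rewrite !ord1 sumE F0 mulr_sumr.
    by apply: eq_bigr => n _; rewrite mul_mpolyC -scalerAr.
  split=> [|i]; first apply/vinvE; rewrite ?ord1 sumE.
    apply: (big_ind (relinv a b)) => [||n _].
    - exact: relinv0.
    - exact: relinvD.
    by have [r ->] := c_const n; rewrite mul_mpolyC; apply: relinvZ.
  apply: rpred_sum => n _; have [r ->] := c_const n; rewrite mul_mpolyC.
  by apply: rpredZ; apply: p_hom.
move=> sum0 n.
pose r m : C := if insub m is Some i then (c i)@_0%MM else 0.
have cE i : c i = (r i)%:MP.
  by rewrite /r valK; have [z ->] := c_const i; rewrite mcoeffC eqxx mulr1.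
rewrite cE (@inv_basis_free (hdim k d) (d - k) r) ?mpolyC0 //.
apply: (mulfI (relgen_neq0 a b)); rewrite mulr0 mulr_sumr.
transitivity (\sum_n c n * p n); last by rewrite -sumE sum0 mxE.
by apply: eq_bigr => i _; rewrite cE mul_mpolyC -scalerAr.
Qed.

Lemma vinv_hilbert : hilbert_series_eq rho 'X^k ((1 - 'X^8) * (1 - 'X^24)).
Proof.
exists (hdim k); split=> [d|]; first exact: vinv_has_dim.
have -> : (1 - 'X^8) * (1 - 'X^24) = 'X^0 - 'X^8 - 'X^24 + 'X^32 :> {poly int}.
  by rewrite expr0; ring.
split=> [|n]; first by rewrite !(coefD, coefN, coefXn).
under eq_bigr => i _ do rewrite !(coefD, coefN) !(mulrDl, mulNr).
rewrite !big_split /= !sumrN.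
rewrite !(coef_Xn_conv (fun d => (hdim k d)%:Z)) /= subn0 coefXn.
by have := hdim_rec k n; do 3!case: ifP => _; lia.
Qed.

End Generator.

End RelativeInvariants.

Theorem theorem1 (R : realType) :
  (* the pairs (a, b) index the one-dimensional representations *)
  (forall (a : 'I_4) (b : 'I_2), exists rho : 'M[R[i]]_2 -> 'M[R[i]]_1,
     is_rep1 ((- 1) ^+ b) ('i ^+ a) rho) /\
  (forall rho : 'M[R[i]]_2 -> 'M[R[i]]_1, is_rep rho ->
     exists! ab : 'I_4 * 'I_2, is_rep1 ((- 1) ^+ ab.2) ('i ^+ ab.1) rho) /\
  (forall (a : 'I_4) (b : 'I_2) (rho rho' : 'M[R[i]]_2 -> 'M[R[i]]_1),
     is_rep1 ((- 1) ^+ b) ('i ^+ a) rho ->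
     is_rep1 ((- 1) ^+ b) ('i ^+ a) rho' ->
     forall g, inG g -> rho g = rho' g) /\
  (forall (a : 'I_4) (b : 'I_2) (rho : 'M[R[i]]_2 -> 'M[R[i]]_1),
     is_rep1 ((- 1) ^+ b) ('i ^+ a) rho ->
     free_gen rho (Gamma R[i] ^+ a * Delta R[i] ^+ b)) /\
  (forall (j : 'I_8) (rho : 'M[R[i]]_2 -> 'M[R[i]]_1),
     is_rep1 (nth (0, 0) (rho_values R[i]) j).1
             (nth (0, 0) (rho_values R[i]) j).2 rho ->
     free_gen rho (rho_generators R[i])`_j /\
     hilbert_series_eq rho 'X^(nth 0%N rho_degrees j)
       ((1 - 'X^8) * (1 - 'X^24))).
Proof.
split; first by move=> a b; apply: rep_exists.
split; first exact: rep_exponents.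
split.
  move=> a b rho rho' [hr rT rD] [hr' rT' rD'].
  by apply: rep_ext; rewrite // (rT, rD).
split=> [a b rho rhoP|].
  by apply: vinv_free_gen rhoP; [exact: ltn_ord | rewrite -ltnS ltn_ord].
move=> j rho.
have gen_and_series a b : (a < 4)%N -> (b <= 1)%N ->
    is_rep1 ((- 1) ^+ b) ('i ^+ a) rho ->
    free_gen rho (relgen R[i] a b) /\
    hilbert_series_eq rho 'X^(6 * a + 12 * b) ((1 - 'X^8) * (1 - 'X^24)).
  by move=> a4 b1 rhoP; split; [apply: vinv_free_gen | apply: vinv_hilbert].
have i2 : 'i ^+ 2 = - 1 :> R[i] := sqrCi _.
have i3 : 'i ^+ 3 = - 'i :> R[i] by rewrite exprS i2 mulrN1.
case: j => [[|[|[|[|[|[|[|[|//]]]]]]]] lt_j] /= rhoP.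
- by have := gen_and_series 0 0; rewrite /relgen mulr1; apply.
- by have := gen_and_series 2 0; rewrite /relgen mulr1 i2; apply.
- by have := gen_and_series 1 0; rewrite /relgen mulr1; apply.
- by have := gen_and_series 3 0; rewrite /relgen mulr1 i3; apply.
- by have := gen_and_series 0 1; rewrite /relgen mul1r; apply.
- by have := gen_and_series 2 1; rewrite /relgen i2; apply.
- by have := gen_and_series 1 1; rewrite /relgen; apply.
by have := gen_and_series 3 1; rewrite /relgen i3; apply.
Qed.
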